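(* Let $T\in\{0,1\}$ be a treatment, $Z$ an observed covariate, $Y(0),Y(1)$ potential outcomes, and $Y=Y(T)$ a.s. the observed outcome. Let $P_{t,t,z}=\mathcal L(Y(t)\mid T=t,Z=z)$, $P_{t,z}=\mathcal L(Y(t)\mid Z=z)$, and let $\Psi$ be a summary map into a Banach space $(E,\|\cdot\|_E)$. Put $\theta_\Psi(z):=\|\Psi(P_{1,z})-\Psi(P_{0,z})\|_E$. Assume positivity, $0<\mathbb P(T=1\mid Z=z)<1$ for $P_Z$-a.e. $z$, and conditional topological ignorability relative to $\Psi$: $\Psi(P_{t,t,z})=\Psi(P_{t,z})$ for $t\in\{0,1\}$ and $P_Z$-a.e. $z$. Then for $P_Z$-a.e. $z$, $$\theta_\Psi(z)=\bigl\|\Psi\bigl(\mathcal L(Y\mid T=1,Z=z)\bigr)-\Psi\bigl(\mathcal L(Y\mid T=0,Z=z)\bigr)\bigr\|_E .$$ Consequently the standardized effect $\tau_\Psi=\int\theta_\Psi(z)\,dP_Z(z)$ is identified by the observational law of $(Y,T,Z)$.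
   Context: All random variables live on a complete probability space. $Z$ takes values in a standard Borel space $\mathcal Z$ with law $P_Z$, and $Y(0),Y(1)$ take values in $\mathcal Y\subseteq\mathbb R^d$. All laws considered admit densities with respect to a common $\sigma$-finite measure on $\mathcal Y$; $f_\mu$ denotes the density of $\mu$. A summary map is $\Psi(\mu):=\Phi(f_\mu)$, where $\Phi$ is a measurable map from a class of densities on $\mathcal Y$ into a Banach space $(E,\|\cdot\|_E)$; it need not be injective. A quantity is identified by the observational law of $(Y,T,Z)$ if it is determined by that law, i.e. any two models satisfying the stated assumptions and inducing the same joint law of $(Y,T,Z)$ give it the same value. *)

(* Defs.v *)
From HB Require Import structures.
From mathcomp Require Import all_boot all_order all_algebra.
From mathcomp Require Import all_classical all_reals all_analysis.
From mathcomp Require Import measurable_realfun.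

Set Implicit Arguments.
Unset Strict Implicit.
Unset Printing Implicit Defensive.

Import Order.TTheory GRing.Theory Num.Theory.
Import numFieldNormedType.Exports.

Local Open Scope classical_set_scope.
Local Open Scope ring_scope.

(* Measurable types are pointed, so the subset carries a proof [hS] that it is
   nonempty; [hS] has no other role. *)
Definition outcome_set (R : realType) (d : nat) (S : set 'rV[R]_d)
  (hS : S !=set0) : Type := set_type S.

Section outcome_set_instances.
Variables (R : realType) (d : nat) (S : set 'rV[R]_d) (hS : S !=set0).

HB.instance Definition _ := Topological.copy (outcome_set hS) (set_type S).

Fact outcome_set_point : outcome_set hS.
Proof. by case: (cid hS) => y Sy; exists y; exact: mem_set. Qed.

HB.instance Definition _ := isPointed.Build (outcome_set hS) outcome_set_point.

End outcome_set_instances.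

Notation borel T := (g_sigma_algebraType (@open T)).

Definition standard_borel (R : realType) (dZ : measure_display)
    (Zs : measurableType dZ) : Prop :=
  exists (S : completePseudoMetricType R) (f : Zs -> S),
    [/\ hausdorff_space S,
        exists2 D : set S, countable D & dense D,
        bijective f &
        forall A : set Zs,
          measurable A <-> exists2 B, <<s @open S >> B & A = f @^-1` B].

Section densities.
Variables (R : realType) (dY : measure_display) (Ys : measurableType dY).
Variable nu : {sigma_finite_measure set Ys -> \bar R}.

Definition density_fun (f : Ys -> R) : Prop :=
  [/\ measurable_fun setT f, forall y, 0 <= f y
    & (\int[nu]_y (f y)%:E = 1)%E].

Definition density_of (mu : {measure set Ys -> \bar R}) (f : Ys -> R) : Prop :=
  forall B, measurable B -> (mu B = \int[nu]_(y in B) (f y)%:E)%E.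

(* The Borel sigma-algebra of the L^1(nu) distance on the class [D]. *)
Definition L1_borel (D : set (Ys -> R)) : set (set (Ys -> R)) :=
  <<s D, [set U | U `<=` D /\
    forall f, U f -> exists2 e : R, 0 < e &
      forall g, D g ->
        (\int[nu]_y `|f y - g y|%:E < e%:E)%E -> U g] >>.

(* The class [dens_class] need not be closed under nu-a.e. equality (it may
   consist of continuous densities, say). Every member of [L1_borel] is
   invariant under nu-a.e. equality inside the class, so [Phi_measurable] forces
   [Phi] to agree on two densities of the same law in the class: see [summaryE]
   below. Values of [Phi] outside [dens_class] are junk. *)
Record summary_map (E : completeNormedModType R) := SummaryMap {
  dens_class : set (Ys -> R);
  dens_classP : dens_class `<=` density_fun;
  Phi : (Ys -> R) -> E;
  Phi_measurable : forall B : set E, <<s @open E >> B ->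
    L1_borel dens_class (dens_class `&` Phi @^-1` B)
}.

Variables (E : completeNormedModType R) (S : summary_map E).

Definition has_density (mu : {measure set Ys -> \bar R}) : Prop :=
  exists2 f, dens_class S f & density_of mu f.

Definition summary (mu : {measure set Ys -> \bar R}) : E :=
  Phi S (xget (fun=> 0) [set f | dens_class S f /\ density_of mu f]).

Lemma L1_borel_sep (D U : set (Ys -> R)) (f g : Ys -> R) : D f -> D g ->
  (\int[nu]_y `|f y - g y|%:E = 0)%E -> L1_borel D U -> U f <-> U g.
Proof.
move=> Df Dg fg0.
have : L1_borel D `<=` [set V | V f <-> V g]; last exact.
apply: smallest_sub.
  split=> [//|A /= Afg|F /= Ffg].
  - by split=> -[_ NA]; split=> // /Afg.
  - by split=> -[n _ Fn]; exists n => //; exact/Ffg.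
move=> {}U [UD Uopen] /=; split=> Ux.
- by have [e e0 +] := Uopen _ Ux; apply=> //; rewrite fg0 lte_fin.
- have [e e0 +] := Uopen _ Ux; apply=> //.
  by under eq_integral do rewrite distrC; rewrite fg0 lte_fin.
Qed.

Lemma density_of_uniq (mu : {measure set Ys -> \bar R}) (f g : Ys -> R) :
  density_fun f -> density_fun g -> density_of mu f -> density_of mu g ->
  (\int[nu]_y `|f y - g y|%:E = 0)%E.
Proof.
move=> [mf f0 f1] [mg g0 g1] fmu gmu.
have intf : nu.-integrable setT (EFin \o f).
  apply/integrableP; split; first exact/measurable_EFinP.
  under eq_integral do rewrite /= ger0_norm//.
  by rewrite f1 ltry.
have fg : ae_eq nu setT (EFin \o f) (EFin \o g).
  apply: integral_ae_eq => //; first exact/measurable_EFinP.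
  by move=> B _ mB; rewrite -fmu// gmu.
rewrite (ae_eq_integral (cst 0%E)) ?integral0//.
- exact/measurable_EFinP/measurableT_comp/measurable_funB.
- by apply: filterS fg => y /= /(_ I)[->] _; rewrite subrr normr0.
Qed.

Lemma summaryE (mu : {measure set Ys -> \bar R}) (f : Ys -> R) :
  dens_class S f -> density_of mu f -> summary mu = Phi S f.
Proof.
move=> Sf fmu; rewrite /summary; case: xgetP => [g _ [Sg gmu]|/(_ f)[]//].
have g0 := density_of_uniq (dens_classP Sg) (dens_classP Sf) gmu fmu.
have mB : <<s @open E >> [set Phi S f].
  rewrite -[X in <<s _ >> X]setCK; apply: sigma_algebraC.
  apply: sub_sigma_algebra; rewrite openC.
  exact/accessible_closed_set1/hausdorff_accessible/norm_hausdorff.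
by have [_ []] := L1_borel_sep Sg Sf g0 (Phi_measurable mB).
Qed.

End densities.

(* [K] is a regular version of w |-> L(X | W = w): it is defined on the whole
   range of [W] and determined up to a null set of the law of [W]. *)
Definition cond_law (R : realType) (dO dW dX : measure_display)
    (Om : measurableType dO) (Ws : measurableType dW) (Xs : measurableType dX)
    (P : probability Om R) (X : Om -> Xs) (W : Om -> Ws)
    (K : R.-pker Ws ~> Xs) : Prop :=
  forall (A : set Ws) (B : set Xs), measurable A -> measurable B ->
    (P (W @^-1` A `&` X @^-1` B) = \int[P]_(w in W @^-1` A) K (W w) B)%E.

Section potential_outcomes.
Variables (R : realType) (dZ dY : measure_display).
Variables (Zs : measurableType dZ) (Ys : measurableType dY).

(* Treatment values 0 and 1 are [false] and [true]. A model carries arbitrary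
   versions of the conditional laws; L(. | T = t, Z = z) is the conditional law
   given the pair (T, Z), taken at (t, z):
     propensity z {true} = P(T = 1 | Z = z),
     arm_law t (s, z)    = L(Y(t) | T = s, Z = z),
     po_law t z          = L(Y(t) | Z = z). *)
Record model := Model {
  disp : measure_display;
  Omega : measurableType disp;
  prob : probability Omega R;
  prob_complete : measure_is_complete prob;
  treat : {mfun Omega >-> bool};
  covar : {mfun Omega >-> Zs};
  outcome : {mfun Omega >-> Ys};
  potential : bool -> {mfun Omega >-> Ys};
  consistency : {ae prob, forall w, outcome w = potential (treat w) w};
  propensity : R.-pker Zs ~> bool;
  propensityP : cond_law prob treat covar propensity;
  arm_law : bool -> R.-pker (bool * Zs)%type ~> Ys;
  arm_lawP : forall t,
    cond_law prob (potential t) (fun w => (treat w, covar w)) (arm_law t);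
  po_law : bool -> R.-pker Zs ~> Ys;
  po_lawP : forall t, cond_law prob (potential t) covar (po_law t)
}.

Definition covar_law (M : model) : probability Zs R :=
  distribution (prob M) (covar M).

Definition obs_law (M : model) : set (Ys * bool * Zs) -> \bar R :=
  pushforward (prob M) (fun w => (outcome M w, treat M w, covar M w)).

Definition positivity (M : model) : Prop :=
  {ae covar_law M, forall z, (0 < propensity M z [set true] < 1)%E}.

(* A version of z |-> L(Y | T = t, Z = z), as the value at (t, z). *)
Definition obs_arm_law (M : model) (Q : R.-pker (bool * Zs)%type ~> Ys) : Prop :=
  cond_law (prob M) (outcome M) (fun w => (treat M w, covar M w)) Q.

Variable nu : {sigma_finite_measure set Ys -> \bar R}.
Variables (E : completeNormedModType R) (S : summary_map nu E).

Definition laws_have_densities (M : model) : Prop :=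
  {ae covar_law M, forall z, forall t,
    has_density S (po_law M t z) /\ has_density S (arm_law M t (t, z))}.

Definition ignorability (M : model) : Prop :=
  forall t, {ae covar_law M, forall z,
    summary S (arm_law M t (t, z)) = summary S (po_law M t z)}.

Definition admissible (M : model) : Prop :=
  [/\ positivity M, laws_have_densities M & ignorability M].

Definition theta (M : model) (z : Zs) : R :=
  `|summary S (po_law M true z) - summary S (po_law M false z)|.

Definition tau (M : model) : \bar R :=
  (\int[covar_law M]_z (theta M z)%:E)%E.

Definition identified (V : Type) (q : model -> V) : Prop :=
  forall M M' : model, admissible M -> admissible M' ->
    (forall C, measurable C -> obs_law M C = obs_law M' C) -> q M = q M'.

End potential_outcomes.

(* Main.v *)
(* Given T = t the observed outcome is Y(t), so L(Y(t) | T = t, Z = z) and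
   L(Y | T = t, Z = z) have the same integrals against the law of (T, Z) on
   {t} x Z. They therefore agree on each set of a countable pi-system generating
   the Borel sets of the outcome space, hence as measures, off a set that is null
   for the law of (T, Z); positivity makes its section at t null for the law of
   Z. Ignorability then rewrites theta in terms of L(Y | T, Z), which the law of
   (Y, T, Z) determines almost everywhere. *)
Require Import Defs.
From HB Require Import structures.
From mathcomp Require Import all_boot all_order all_algebra.
From mathcomp Require Import all_classical all_reals all_analysis.
From mathcomp Require Import measurable_realfun.
Import Order.TTheory GRing.Theory Num.Theory.
Import numFieldNormedType.Exports.
Local Open Scope classical_set_scope.
Local Open Scope ring_scope.

(** * Second countability and countable pi-systems of Borel sets *)

(** Finite intersections of basic open sets are countable in number and closed under intersection;
    they generate the Borel sets because each open set is a countable union of basic ones. *)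
Lemma second_countable_pi_system (T : topologicalType) :
  @second_countable T ->
  exists G : nat -> set T,
    [/\ setI_closed (range G), range G setT & <<s range G >> = <<s open >>].
Proof.
move=> [B /countable_injP[i iinj] [Bopen Bbasis]].
(* [b n] is the basic open set of index [n], or [setT] if there is none. *)
pose b n := \bigcap_(U in [set U | B U /\ i U = n]) U.
have bE U : B U -> b (i U) = U.
  move=> BU; apply/seteqP; split=> [x|x Ux V [BV /iinj]]; first exact.
  by rewrite !inE => ->.
pose F (s : seq nat) := \big[setI/setT]_(n <- s) b n.
(* Numbers that code no finite sequence are sent to [setT], the empty intersection, so [G] has no
   more values than [F]. *)
pose G n := oapp F setT (choice.unpickle n).
have rangeG : range G = range F.
  apply/seteqP; split=> [_ [n _ <-]|_ [s _ <-]]; rewrite /G.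
    case: (choice.unpickle n) => [s|]; first by exists s.
    by exists [::]; rewrite // /F big_nil.
  by exists (choice.pickle s) => //; rewrite choice.pickleK.
have bopen n : open (b n).
  have [[U [BU <-]]|nU] := pselect (exists U, B U /\ i U = n).
    by rewrite bE//; exact: Bopen.
  suff -> : b n = setT by exact: openT.
  by apply/seteqP; split=> // x _ U BU; exfalso; apply: nU; exists U.
exists G; rewrite rangeG; split.
- move=> _ _ [s _ <-] [t _ <-]; exists (s ++ t) => //.
  by rewrite /F big_cat.
- by exists [::] => //; rewrite /F big_nil.
apply/seteqP; split.
  apply: sub_sigma_algebra2 => _ [s _ <-]; rewrite /F.
  by elim/big_ind : _ => [|U V oU oV|n _]; [exact: openT|exact: openI|].
apply: smallest_sub; first exact: smallest_sigma_algebra.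
move=> O oO.
suff -> : O = \bigcup_n (if `[< b n `<=` O >] then b n else set0).
  apply: sigma_algebra_bigcup => n; case: ifPn => _; last exact: sigma_algebra0.
  by apply: sub_sigma_algebra; exists [:: n] => //; rewrite /F big_seq1.
apply/seteqP; split=> [x Ox|x [n _]]; last by case: ifPn => // /asboolP; exact.
have /Bbasis[U [BU Ux] UO] : nbhs x O by exact: open_nbhs_nbhs.
by exists (i U) => //; rewrite bE//; case: asboolP.
Qed.

Lemma dense_second_countable (R : realType) (T : pseudoMetricType R)
    (D : set T) : countable D -> dense D -> @second_countable T.
Proof.
move=> cD dD.
(* Interiors are taken because a ball of a pseudometric structure need not be open. *)
pose b (xn : T * nat) := (ball xn.1 (xn.2.+1%:R^-1 : R))°.
exists (b @` (D `*` setT)).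
  by apply: (card_le_trans (card_image_le _ _)); exact: countableX.
split=> [_ [xn _ <-]|x U /nbhs_ballP[_/posnumP[e] eU]].
  exact: open_interior.
near \oo => n.
(* The dense point [y] is sought at half the radius: the half ball about [x] then lies in the full
   ball about [y], so [x] is interior to the latter. The later choice of [n] makes the ball about
   [y] fit in the ball of radius [e] about [x]. *)
have n0 : 0 < (n.+1%:R^-1 : R) / 2 by rewrite divr_gt0.
have [y [/interior_subset xy Dy]] : (ball x (n.+1%:R^-1 / 2))° `&` D !=set0.
  apply: dD; last exact: open_interior.
  by exists x; exact: nbhsx_ballx.
exists (b (y, n)); first split.
- by exists (y, n).
- apply/nbhs_ballP; exists (n.+1%:R^-1 / 2) => //= z.
  exact/ball_split/ball_sym.
- move=> z /interior_subset yz; apply: eU.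
  apply: (@ball_split _ _ y).
    apply: le_ball xy; rewrite ler_pM2r// ltW//.
    by near: n; exact: near_infty_natSinv_lt.
  apply: le_ball yz; rewrite /= ltW//.
  by near: n; exact: (near_infty_natSinv_lt (e%:num / 2)%:pos).
Unshelve. all: end_near. Qed.

Lemma rV_second_countable (R : realType) d : @second_countable 'rV[R]_d.
Proof.
apply: (@dense_second_countable R ('rV[R]_d : pseudoMetricType R)
  (map_mx ratr @` [set: 'rV[rat]_d])).
  by apply: (card_le_trans (card_image_le _ _)); exact: countableP.
move=> O [x Ox] oO.
have /nbhs_ballP[e e0 eO] : nbhs x O by exact: open_nbhs_nbhs.
(* Balls of row vectors are taken coordinatewise, so rational approximations may be chosen
   separately in each coordinate. *)
have /choice[q qP] : forall j, exists q : rat, ball (x 0 j) e (ratr q).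
  move=> j; have [y [xy [q _ qy]]] : ball (x 0 j) e `&` (@ratr R @` setT) !=set0.
    apply: dense_rat; last exact: ball_open.
    by exists (x 0 j); exact: ballxx.
  by exists q; rewrite qy.
exists (map_mx ratr (\row_j q j)); split; last by exists (\row_j q j).
by apply: eO; split=> // i j; rewrite !mxE ord1; exact: qP.
Qed.

(** Serves for [outcome_set], whose topology is initial for the inclusion into the row vectors. *)
Lemma initial_second_countable (S : choiceType) (T : topologicalType)
    (f : S -> T) :
  @second_countable T -> @second_countable (initial_topology f).
Proof.
move=> [B cB [Bopen Bbasis]].
exists ((fun U => f @^-1` U) @` B).
  by apply: (card_le_trans (card_image_le _ _)); exact: cB.
split=> [_ [U BU <-]|x V [W [[U oU <-] Ux UV]]].
  by exists U => //; exact: Bopen.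
have /Bbasis[P [BP Px] PU] : nbhs (f x) U by exact: open_nbhs_nbhs.
exists (f @^-1` P); first by split=> //; exists P.
by move=> y /PU/UV.
Qed.

Lemma outcome_set_second_countable (R : realType) (d : nat)
    (Yset : set 'rV[R]_d) (hY : Yset !=set0) :
  @second_countable (outcome_set hY).
Proof. exact/initial_second_countable/rV_second_countable. Qed.

(** * Almost-everywhere comparison of integrals, kernels and measures *)

Import HBNNSimple.

(* [f] and [g] need not be measurable: the integral is a supremum over simple
   functions, which may be cut off on the exceptional null set. This matters
   because [theta] is not assumed measurable. *)
Lemma integral_ae_le d (T : measurableType d) (R : realType)
    (mu : {measure set T -> \bar R}) (f g : T -> \bar R) :
  (forall x, 0 <= f x)%E -> (forall x, 0 <= g x)%E ->
  {ae mu, forall x, (f x <= g x)%E} ->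
  (\int[mu]_x f x <= \int[mu]_x g x)%E.
Proof.
move=> f0 g0 [N [mN N0 subN]].
rewrite (ge0_integralTE mu f0) (ge0_integralTE mu g0).
apply: ge_ereal_sup => _ [h /= hf <-].
have mNC : measurable (~` N) by exact: measurableC.
have projE x : proj_nnsfun h mNC x = h x * (x \in ~` N)%:R.
  by rewrite -indicE.
apply: ereal_sup_ubound; exists (proj_nnsfun h mNC) => [x|].
  rewrite projE; case: (boolP (x \in ~` N)) => [|_].
    rewrite mulr1 inE => xN; apply: (le_trans (hf x)).
    by apply: contrapT => fg; apply/xN/subN.
  by rewrite mulr0.
rewrite -!integralT_nnsfun [RHS](ge0_negligible_integral mN)//; last first.
  by move=> x _; rewrite lee_fin.
  exact/measurable_EFinP.
rewrite setTD [RHS]integral_mkcond; apply: eq_integral => x _.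
rewrite patchE projE; case: ifPn => _; first by rewrite mulr1.
by rewrite mulr0.
Qed.

(** Each [G n] costs one null set. Off their countable union the two probability measures agree on a
    pi-system, so a single null set serves all measurable [B]. *)
Lemma kernel_ae_eq (R : realType) d1 d2 (W : measurableType d1)
    (V : measurableType d2) (mu : {finite_measure set W -> \bar R})
    (k1 k2 : R.-pker W ~> V) (D : set W) (G : nat -> set V) :
  setI_closed (range G) -> range G setT -> measurable = <<s range G >> ->
  measurable D ->
  (forall A B, measurable A -> A `<=` D -> measurable B ->
    (\int[mu]_(w in A) k1 w B = \int[mu]_(w in A) k2 w B)%E) ->
  {ae mu, forall w, D w -> forall B, measurable B -> k1 w B = k2 w B}.
Proof.
move=> GI GT mG mD k12.
have mGn n : measurable (G n) by rewrite mG; apply: sub_sigma_algebra; exists n.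
have : {ae mu, forall w, forall n, D w -> k1 w (G n) = k2 w (G n)}.
  apply: ae_foralln => n; apply: integral_ae_eq => //.
  (* Probability kernels are bounded by 1, which is integrable as [mu] is finite. *)
  - have := finite_measure_integrable_cst mu 1 mD.
    apply: le_integrable => //; first exact/measurable_funTS/measurable_kernel.
    move=> w _ /=; rewrite normr1 gee0_abs//.
    by rewrite -(@prob_kernel _ _ _ _ _ k1 w) le_measure// inE.
  - exact/measurable_funTS/measurable_kernel.
  - by move=> A AD mA; exact: k12.
apply: filterS => w kG Dw B mB.
(* The exhausting sequence is constantly [setT], which lies in the range of [G] and has mass 1. *)
apply: (measure_unique (range G) (fun=> setT)) => //.
- by rewrite bigcup_const.
- by move=> _ [n _ <-]; exact: kG.
- by move=> _; rewrite prob_kernel ltry.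
Qed.

Lemma measure_ae_eq d (T : measurableType d) (R : realType)
    (mu : {measure set T -> \bar R}) (A B : set T) :
  measurable A -> measurable B -> {ae mu, forall x, A x <-> B x} ->
  mu A = mu B.
Proof.
move=> mA mB AB.
have {}AB : (\1_A : T -> R) = \1_B %[ae mu].
  apply: filterS AB => x AB _; rewrite !indicE; congr (nat_of_bool _)%:R.
  by apply/idP/idP; rewrite !inE => /AB.
rewrite -[A]setIT -[B]setIT -!integral_indic//.
apply: ae_eq_integral => //; [exact/measurable_EFinP/measurable_indic..|].
by apply: filterS AB => x /(_ I) -> .
Qed.

(** * Conditional laws on one treatment arm *)

Section models.
Context {R : realType} {dZ dY : measure_display} {Zs : measurableType dZ}
  {Ys : measurableType dY}.
Implicit Types M : model R Zs Ys.

(** Named so as to carry the structure of a measurable function; it unfolds to the conditioning map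
    of [arm_lawP] and [obs_arm_law]. *)
Definition treat_covar M (w : Omega M) : bool * Zs := (treat M w, covar M w).

Lemma measurable_treat_covar M : measurable_fun setT (@treat_covar M).
Proof. exact: measurable_fun_pair. Qed.

HB.instance Definition _ M :=
  isMeasurableFun.Build _ _ _ _ (@treat_covar M) (measurable_treat_covar M).

Definition treat_covar_law M : probability (bool * Zs)%type R :=
  distribution (prob M) (@treat_covar M).

(** The integral is the probability that (T, Z) is in [A] and [X] in [B]; on that event T = t, so
    [X] can be exchanged for the outcome. Leaving [X] free covers both [potential M t] and
    [outcome M]. *)
Lemma integral_cond_law_obs M (t : bool) (X : {mfun Omega M >-> Ys})
    (K : R.-pker (bool * Zs)%type ~> Ys) (A : set (bool * Zs)) (B : set Ys) :
  cond_law (prob M) X (@treat_covar M) K ->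
  {ae prob M, forall w, treat M w = t -> outcome M w = X w} ->
  measurable A -> A `<=` [set w | w.1 = t] -> measurable B ->
  (\int[treat_covar_law M]_(w in A) K w B =
   obs_law M [set x | A (x.1.2, x.2) /\ B x.1.1])%E.
Proof.
move=> KX Xt mA At mB.
rewrite ge0_integral_pushforward//; last first.
  exact/measurable_funTS/measurable_kernel.
transitivity (prob M (@treat_covar M @^-1` A `&` X @^-1` B)); first exact/esym/KX.
have mTA : measurable (@treat_covar M @^-1` A).
  by rewrite -[X in measurable X]setTI; exact: measurable_treat_covar.
apply: measure_ae_eq.
- by apply: measurableI => //; rewrite -[X in measurable X]setTI; exact: measurable_funP.
- apply: measurableI => //; rewrite -[X in measurable X]setTI; exact: measurable_funP.
- by apply: filterS Xt => w Xt /=; split=> -[Aw Bw]; split=> //;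
    move: Bw; rewrite /= Xt//; exact: (At _ Aw).
Qed.

Lemma eq_treat_covar_law M M' :
  (forall C, measurable C -> obs_law M C = obs_law M' C) ->
  forall A, measurable A -> treat_covar_law M A = treat_covar_law M' A.
Proof.
move=> MM' A mA.
apply: (MM' [set x | A (x.1.2, x.2)]).
have mf : measurable_fun setT (fun x : Ys * bool * Zs => (x.1.2, x.2)).
  by apply: measurable_fun_pair => //; exact: measurableT_comp.
by rewrite -[X in measurable X]setTI; exact: mf.
Qed.

Lemma eq_covar_law M M' :
  (forall C, measurable C -> obs_law M C = obs_law M' C) ->
  forall A, measurable A -> covar_law M A = covar_law M' A.
Proof.
move=> MM' A mA; apply: (MM' [set x | A x.2]).
by rewrite -[X in measurable X]setTI; exact: measurable_snd.
Qed.

(** The two propensities sum to 1, so the upper bound in [positivity] is what handles the untreated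
    arm. *)
Lemma propensity_gt0 M (t : bool) : positivity M ->
  {ae covar_law M, forall z, (0 < propensity M z [set t])%E}.
Proof.
apply: filterS => z /andP[p0 p1]; case: t => //.
rewrite lt0e measure_ge0 andbT; apply/eqP => pf0.
have pT : (propensity M z [set true] + propensity M z [set false] = 1)%E.
  transitivity (propensity M z [set: bool]); last exact: prob_kernel.
  have -> : [set: bool] = [set true] `|` [set false].
    by apply/seteqP; split=> // -[] _; [left|right].
  by rewrite measureU//; apply/seteqP; split=> // b [/= ->].
by move: p1; rewrite -pT pf0 adde0 ltxx.
Qed.

(** The mass of {t} x [N] is the integral over [N] of the propensity of t. If it vanishes, the
    propensity is zero almost everywhere on [N], which positivity allows only when [N] is null. *)
Lemma arm_negligible M (t : bool) (N : set Zs) : positivity M -> measurable N ->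
  treat_covar_law M [set w | w.1 = t /\ N w.2] = 0%E -> covar_law M N = 0%E.
Proof.
move=> pM mN N0.
have mp : measurable_fun N (fun z => propensity M z [set t]).
  exact/measurable_funTS/measurable_kernel.
have p0 : (\int[covar_law M]_(z in N) `|propensity M z [set t]| = 0)%E.
  under eq_integral do rewrite gee0_abs//.
  rewrite ge0_integral_pushforward//.
  rewrite -[RHS]N0 -(@propensityP _ _ _ _ _ M _ [set t] mN)//.
  by congr (prob M _); apply/seteqP; split=> w [].
have {p0} /ae_eq_integral_abs := p0; move=> /(_ mN mp) p0.
have [N' [mN' N'0 NN']] : {ae covar_law M, forall z, ~ N z}.
  apply: filterS2 p0 (propensity_gt0 _ t pM) => z pN p0 Nz.
  by move: p0; rewrite pN// ltxx.
apply: (subset_measure0 mN mN' _ N'0) => z Nz; apply: NN' => /=.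
exact.
Qed.

Lemma measurable_arm (t : bool) :
  measurable [set w : bool * Zs | w.1 = t].
Proof.
rewrite -[X in measurable X]setTI.
exact: (@measurable_fst _ _ bool Zs measurableT [set t]).
Qed.

(** Integrals of both kernels over subsets of the arm reduce to the common observational law. With
    [M'] equal to [M] this compares a potential outcome with the observed one; with [M'] distinct it
    compares two models. *)
Lemma arm_law_unique M M' (t : bool)
    (X : {mfun Omega M >-> Ys}) (X' : {mfun Omega M' >-> Ys})
    (K K' : R.-pker (bool * Zs)%type ~> Ys) (G : nat -> set Ys) :
  setI_closed (range G) -> range G setT -> measurable = <<s range G >> ->
  positivity M -> (forall C, measurable C -> obs_law M C = obs_law M' C) ->
  cond_law (prob M) X (@treat_covar M) K ->
  {ae prob M, forall w, treat M w = t -> outcome M w = X w} ->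
  cond_law (prob M') X' (@treat_covar M') K' ->
  {ae prob M', forall w, treat M' w = t -> outcome M' w = X' w} ->
  {ae covar_law M, forall z, forall B, measurable B -> K (t, z) B = K' (t, z) B}.
Proof.
move=> GI GT mG pM MM' KX Xt KX' Xt'.
have [|N [mN N0 NK]] := kernel_ae_eq _ _ _ _ _ (treat_covar_law M) K K' _ G
  GI GT mG (measurable_arm t).
  move=> A B mA At mB.
  rewrite (integral_cond_law_obs _ _ _ _ _ _ KX Xt)//.
  rewrite (eq_measure_integral (treat_covar_law M')); last first.
    by move=> C mC _; exact: eq_treat_covar_law.
  rewrite (integral_cond_law_obs _ _ _ _ _ _ KX' Xt')//; apply: MM'.
  have mf : measurable_fun setT (fun x : Ys * bool * Zs => (x.1.2, x.2)).
    by apply: measurable_fun_pair => //; exact: measurableT_comp.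
  have mg : measurable_fun setT (fun x : Ys * bool * Zs => x.1.1).
    exact: measurableT_comp.
  apply: measurableI; rewrite -[X in measurable X]setTI; [exact: mf|exact: mg].
(* The exceptional set for Z is the section of [N] at t; {t} times this section lies in [N], hence
   is null. *)
have mNt : measurable [set z | N (t, z)].
  rewrite -[X in measurable X]setTI.
  exact: (pair1_measurable t measurableT).
exists [set z | N (t, z)]; split => //.
  apply: (arm_negligible _ t) => //.
  apply: (subset_measure0 _ mN _ N0).
    apply: measurableI; first exact: measurable_arm.
    rewrite -[X in measurable X]setTI; exact: (measurable_snd measurableT).
  by move=> [s z] /= [->].
by move=> z /= zK; apply: NK => /= tzK; apply: zK; exact: tzK.
Qed.

End models.

(** * Transfer along equal laws, and identification of the effect *)

Lemma eq_measure_ae d (T : measurableType d) (R : realType)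
    (mu mu' : {measure set T -> \bar R}) (P : T -> Prop) :
  (forall A, measurable A -> mu A = mu' A) ->
  {ae mu, forall x, P x} -> {ae mu', forall x, P x}.
Proof. by move=> mumu' [N [mN N0 NP]]; exists N; rewrite -mumu'. Qed.

(** Equal laws have the same set of densities in the class, so [xget] selects the same one. *)
Lemma eq_summary (R : realType) (dY : measure_display)
    (Ys : measurableType dY) (nu : {sigma_finite_measure set Ys -> \bar R})
    (E : completeNormedModType R) (S : summary_map nu E)
    (mu mu' : {measure set Ys -> \bar R}) :
  (forall B, measurable B -> mu B = mu' B) -> summary S mu = summary S mu'.
Proof.
move=> mumu'; congr (Phi S (xget _ _)).
by apply/seteqP; split=> f [Sf fmu]; split=> // B mB;
  [rewrite -mumu'|rewrite mumu']; rewrite ?fmu.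
Qed.

Theorem proposition6 (R : realType) (dZ : measure_display)
    (Zs : measurableType dZ) (hZ : standard_borel R Zs)
    (d : nat) (Yset : set 'rV[R]_d) (hY : Yset !=set0)
    (nu : {sigma_finite_measure set (borel (outcome_set hY)) -> \bar R})
    (E : completeNormedModType R) (S : summary_map nu E) :
  (forall (M : model R Zs (borel (outcome_set hY)))
      (Q : R.-pker (bool * Zs)%type ~> borel (outcome_set hY)),
    admissible S M -> obs_arm_law M Q ->
    {ae covar_law M, forall z,
      theta S M z = `|summary S (Q (true, z)) - summary S (Q (false, z))|}) /\
  identified S (fun M : model R Zs (borel (outcome_set hY)) => tau S M).
Proof.
have [G [GI GT sG]] :=
  second_countable_pi_system _ (outcome_set_second_countable R d Yset hY).
have mG : @measurable _ (borel (outcome_set hY)) = <<s range G >> by rewrite sG.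
have armc (M : model R Zs (borel (outcome_set hY))) t : {ae prob M, forall w,
    treat M w = t -> outcome M w = potential M t w}.
  by apply: filterS (consistency M) => w + <-.
(* Ignorability in [M] combined with uniqueness of the arm law. It is used with [M' = M] and the
   observed outcome for the first claim, and with the potential outcome of the second model for
   identification. *)
have po_arm (M M' : model R Zs (borel (outcome_set hY))) t
    (X : {mfun Omega M' >-> borel (outcome_set hY)})
    (K : R.-pker (bool * Zs)%type ~> borel (outcome_set hY)) :
  admissible S M -> (forall C, measurable C -> obs_law M C = obs_law M' C) ->
  cond_law (prob M') X (@treat_covar _ _ _ _ _ M') K ->
  {ae prob M', forall w, treat M' w = t -> outcome M' w = X w} ->
  {ae covar_law M, forall z, summary S (po_law M t z) = summary S (K (t, z))}.
  move=> [pM _ iM] MM' KX Xt.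
  have KE := arm_law_unique M M' t _ _ _ _
    (G : nat -> set (borel (outcome_set hY))) GI GT mG pM MM'
    (arm_lawP M t) (armc M t) KX Xt.
  by apply: filterS2 (iM t) KE => z <- KE; exact: eq_summary.
split.
  move=> M Q aM QM.
  have poQ t := po_arm M M t (outcome M) Q aM (fun _ _ => erefl) QM
    (aeW _ (fun _ _ => erefl)).
  by apply: filterS2 (poQ true) (poQ false) => z Q1 Q0; rewrite /theta Q1 Q0.
move=> M M' aM aM' MM'; rewrite /tau.
(* Both effects are first written as integrals against the same covariate law. *)
rewrite (_ : (\int[covar_law M']_z (theta S M' z)%:E =
  \int[covar_law M]_z (theta S M' z)%:E)%E); last first.
  apply: eq_measure_integral => A mA _; exact: esym (eq_covar_law M M' MM' A mA).
have poE t : {ae covar_law M, forall z,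
    summary S (po_law M t z) = summary S (po_law M' t z)}.
  have [_ _ iM'] := aM'.
  (* Ignorability of [M'] holds off a null set of its own covariate law, which has to be null for
     that of [M] too. *)
  have {}iM' := eq_measure_ae _ _ _ _ _ _
    (fun A mA => esym (eq_covar_law _ _ MM' A mA)) (iM' t).
  by apply: filterS2 iM' (po_arm M M' t _ _ aM MM' (arm_lawP M' t) (armc M' t))
    => z <-.
have thetaE : {ae covar_law M, forall z, theta S M z = theta S M' z}.
  by apply: filterS2 (poE true) (poE false) => z E1 E0; rewrite /theta E1 E0.
(* Two inequalities are used because [theta] may fail to be measurable. *)
apply/eqP; rewrite eq_le; apply/andP; split; apply: integral_ae_le => [x|x|];
  rewrite ?lee_fin// /theta ?normr_ge0//.
  by apply: filterS thetaE => z; rewrite /theta lee_fin => ->.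
  by apply: filterS thetaE => z; rewrite /theta lee_fin => ->.
Qed.
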